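(* Let $\mathcal{C},\mathcal{D}$ be $A_\infty$-categories over a field $K$, let $a\in\{1,2\}$, and let $\mathfrak{f}=\{f;f_1,f_2,\dots\}:\mathcal{D}\to\mathcal{C}$ be an $A_\infty$-functor. Then $\mathfrak{f}$ induces an $A_\infty$-functor $\mathfrak{f}^{(a)}:\tilde{\mathcal{D}}^{(a)}\to\tilde{\mathcal{C}}^{(a)}$ between the additive enlargements, which is defined (on objects by $X_1[r_1]\oplus\cdots\oplus X_l[r_l]\mapsto f(X_1)[r_1]\oplus\cdots\oplus f(X_l)[r_l]$, and on morphisms by multilinear, matrix-wise extension) by $$f^{(a)}_k(\bar\alpha'_{12},\dots,\bar\alpha'_{k(k+1)}):=\bigl(f_k(\bar\alpha_{12},\dots,\bar\alpha_{k(k+1)})\bigr)'\in s\tilde{\mathcal{C}}^{(a)}(f(X_1)[r_1],f(X_{k+1})[r_{k+1}])$$ for all $k\ge 1$, objects $X_1,\dots,X_{k+1}$ of $\mathcal{D}$, integers $r_1,\dots,r_{k+1}$, and $\bar\alpha_{i(i+1)}\in s\mathcal{D}(X_i,X_{i+1})$ with corresponding $\bar\alpha'_{i(i+1)}\in s\tilde{\mathcal{D}}^{(a)}(X_i[r_i],X_{i+1}[r_{i+1}])$.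
   Context: All vector spaces are over a fixed field $K$. **$A_\infty$-categories (suspended notation).** An $A_\infty$-category $\mathcal{C}$ consists of a set of objects, a $\mathbb{Z}$-graded vector space $\mathcal{C}(X,Y)=\oplus_r\mathcal{C}^r(X,Y)$ for each pair of objects, and, writing $s\mathcal{C}(X,Y)$ for the suspension ($s:\mathcal{C}^r(X,Y)\to (s\mathcal{C}(X,Y))^{r-1}$, $\bar\alpha:=s(\alpha)$, $|\bar\alpha|=|\alpha|-1$), degree $1$ multilinear maps $b_n:s\mathcal{C}(X_1,X_2)\otimes\cdots\otimes s\mathcal{C}(X_n,X_{n+1})\to s\mathcal{C}(X_1,X_{n+1})$, $n\ge1$, such that for every $n\ge 1$ and homogeneous composable $\bar a_1,\dots,\bar a_n$, $$0=\sum_{k+l=n+1}\sum_{j=0}^{k-1}(-1)^{|\bar a_1|+\cdots+|\bar a_j|}b_k(\bar a_1,\dots,\bar a_j,b_l(\bar a_{j+1},\dots,\bar a_{j+l}),\bar a_{j+l+1},\dots,\bar a_n).$$ No unitality is assumed. **$A_\infty$-functors.** An $A_\infty$-functor $\mathfrak{f}=\{f;f_1,f_2,\dots\}:\mathcal{D}\to\mathcal{C}$ is a map $f$ on objects with degree $0$ multilinear maps $f_k:s\mathcal{D}(X_1,X_2)\otimes\cdots\otimes s\mathcal{D}(X_k,X_{k+1})\to s\mathcal{C}(f(X_1),f(X_{k+1}))$, $k\ge1$, such that for all $n\ge1$ and homogeneous composable $\bar a_1,\dots,\bar a_n$, $$\sum_{i\ge1}\sum_{j_1+\cdots+j_i=n}b^{\mathcal{C}}_i(f_{j_1}(\bar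 a_1,\dots,\bar a_{j_1}),\dots,f_{j_i}(\dots,\bar a_n))=\sum_{k+l=n+1}\sum_{j=0}^{k-1}(-1)^{|\bar a_1|+\cdots+|\bar a_j|}f_k(\bar a_1,\dots,\bar a_j,b^{\mathcal{D}}_l(\bar a_{j+1},\dots,\bar a_{j+l}),\dots,\bar a_n),$$ where all $j_1,\dots,j_i\ge 1$. **Additive enlargements $\tilde{\mathcal{C}}^{(a)}$, $a=1,2$.** Objects are finite formal direct sums $X_1[r_1]\oplus\cdots\oplus X_l[r_l]$ with $X_i\in\mathcal{C}$, $r_i\in\mathbb{Z}$. Morphism spaces are the direct sums (matrices) of the spaces $\tilde{\mathcal{C}}^r(X[n],Y[m]):=\mathcal{C}^{r+m-n}(X,Y)$. For $\alpha\in\mathcal{C}(X,Y)$, $\alpha'$ denotes the same element regarded in $\tilde{\mathcal{C}}(X[n],Y[m])$ (so $|\alpha'|=|\alpha|+n-m$), and $\bar\alpha':=s(\alpha')$. The $A_\infty$-structure is the multilinear extension (summing over intermediate direct summands, as in matrix multiplication) of $$\tilde b^{(1)}_k(\bar\alpha'_{12},\dots,\bar\alpha'_{k(k+1)})=(-1)^{r_1}\bigl(b_k(\bar\alpha_{12},\dots,\bar\alpha_{k(k+1)})\bigr)',$$ $$\tilde b^{(2)}_k(\bar\alpha'_{12},\dots,\bar\alpha'_{k(k+1)})=(-1)^{r_1+\cdots+r_k}\bigl(b_k(\bar\alpha_{12},\dots,\bar\alpha_{k(k+1)})\bigr)',$$ for $\bar\alpha_{i(i+1)}\in s\mathcal{C}(X_i,X_{i+1})$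 and $\bar\alpha'_{i(i+1)}\in s\tilde{\mathcal{C}}(X_i[r_i],X_{i+1}[r_{i+1}])$. Both $\tilde{\mathcal{C}}^{(1)}$ and $\tilde{\mathcal{C}}^{(2)}$ are $A_\infty$-categories.
   Formalization: For a = 2 the printed formula for f^(2)_k fails the functor relation when char K ≠ 2; the formal statement uses f^(2)_k(ᾱ'_12,…) := (-1)^(r_2+…+r_k) (f_k(ᾱ_12,…))' instead. The case a = 1 is as printed. *)

(* Defs.v *)
From HB Require Import structures.
From mathcomp Require Import all_boot all_order all_algebra.
From mathcomp Require Import zify ring lra.

Set Implicit Arguments.
Unset Strict Implicit.
Unset Printing Implicit Defensive.

Import Order.TTheory GRing.Theory Num.Theory.
Local Open Scope ring_scope.

(* A chain from X to Y is a composable sequence of elements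
   a_1 : H X X_2, ..., a_n : H X_n Y (possibly n = 0, in which case Y = X).
   A family of n-ary operations, n >= 1, on composable sequences is a single
   function on chains, whose n-ary member is its restriction to the chains of
   size n; its value on empty chains is never used. *)
Section Chain.
Variables (O : Type) (H : O -> O -> Type).

Inductive chain : O -> O -> Type :=
| CNil X : chain X X
| CCons X Y Z : H X Y -> chain Y Z -> chain X Z.

Fixpoint csize X Y (c : chain X Y) : nat :=
  if c is CCons _ _ _ _ c' then (csize c').+1 else 0%N.

Fixpoint ccat X Y Z (c : chain X Y) : chain Y Z -> chain X Z :=
  match c with
  | CNil _ => fun e => e
  | CCons _ _ _ a c' => fun e => CCons a (ccat c' e)
  end.

(* cobj c j is the object X_(j+1), so that
   ctake c j = (a_1, ..., a_j) and cdrop c j = (a_(j+1), ..., a_n). *)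
Fixpoint cobj X Y (c : chain X Y) (j : nat) : O :=
  match c with
  | CNil X => X
  | CCons X _ _ _ c' => if j is j'.+1 then cobj c' j' else X
  end.

Fixpoint ctake X Y (c : chain X Y) (j : nat) : chain X (cobj c j) :=
  match c return chain _ (cobj c j) with
  | CNil X => CNil X
  | CCons X _ _ a c' =>
    match j return chain X (if j is j'.+1 then cobj c' j' else X) with
    | 0 => CNil X
    | j'.+1 => CCons a (ctake c' j')
    end
  end.

Fixpoint cdrop X Y (c : chain X Y) (j : nat) : chain (cobj c j) Y :=
  match c return chain (cobj c j) _ with
  | CNil X => CNil X
  | CCons X _ Z a c' =>
    match j return chain (if j is j'.+1 then cobj c' j' else X) Z with
    | 0 => CCons a c'
    | j'.+1 => cdrop c' j'
    end
  end.

(* (a_1, ..., a_j, b (a_(j+1), ..., a_(j+l)), a_(j+l+1), ..., a_n) *)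
Definition cinsert (b : forall X Y, chain X Y -> H X Y)
    X Y (c : chain X Y) (j l : nat) : chain X Y :=
  ccat (ctake c j)
       (CCons (b _ _ (ctake (cdrop c j) l)) (cdrop (cdrop c j) l)).

End Chain.

Arguments CNil {O H} X.
Arguments CCons {O H X Y Z} a c.

(* (f (a_1, ..., a_(j_1)), f (a_(j_1+1), ..., a_(j_1+j_2)), ...) for
   js = [:: j_1; ...; j_i]; the last block is all that remains of c, which
   has size j_i when js is a composition of csize c. *)
Fixpoint cblocks (O O' : Type) (H : O -> O -> Type) (H' : O' -> O' -> Type)
    (f0 : O -> O') (f : forall X Y, chain H X Y -> H' (f0 X) (f0 Y))
    (js : seq nat) X Y (c : chain H X Y) : chain H' (f0 X) (f0 Y) :=
  match js with
  | j :: ((_ :: _) as js') =>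
    CCons (f _ _ (ctake c j)) (cblocks f js' (cdrop c j))
  | _ => CCons (f _ _ c) (CNil (f0 Y))
  end.

Definition is_composition (n : nat) (js : seq nat) : bool :=
  (0%N \notin js) && (sumn js == n).

Section Graded.
Variables (K : fieldType) (V : lmodType K).

(* V is the internal direct sum of the subspaces V^r = {x | gr r x}. *)
Record is_grading (gr : int -> V -> Prop) : Prop := IsGrading {
  grading0 : forall r, gr r 0;
  gradingP : forall r k x y, gr r x -> gr r y -> gr r (k *: x + y);
  grading_span : forall x, exists (rs : seq int) (x_ : int -> V),
    [/\ uniq rs, forall r, gr r (x_ r) & x = \sum_(r <- rs) x_ r];
  grading_free : forall (rs : seq int) (x_ : int -> V),
    uniq rs -> (forall r, gr r (x_ r)) -> \sum_(r <- rs) x_ r = 0 ->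
    forall r, r \in rs -> x_ r = 0
}.

End Graded.

Section AInfinity.
Variable K : fieldType.

(* The suspension s is the identity on underlying vector spaces, so ahom X Y
   also carries sC(X, Y), with the grading sdeg below. *)
Record ainf_data := AInfData {
  aobj : Type;
  ahom : aobj -> aobj -> lmodType K;
  adeg : forall X Y, int -> ahom X Y -> Prop;
  aop : forall X Y, chain ahom X Y -> ahom X Y
}.

Definition achain (C : ainf_data) : aobj C -> aobj C -> Type := chain (@ahom C).

Definition sdeg (C : ainf_data) (X Y : aobj C) (d : int) (a : ahom X Y) : Prop :=
  adeg (d + 1) a.

(* the elements of c are homogeneous, of suspended degrees ds *)
Fixpoint homogeneous (C : ainf_data) (X Y : aobj C) (c : achain X Y)
    (ds : seq int) : Prop :=
  match c, ds with
  | CNil _, [::] => True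
  | CCons _ _ _ a c', d :: ds' => sdeg d a /\ homogeneous c' ds'
  | _, _ => False
  end.

Definition is_multilinear (C : ainf_data) (X Y : aobj C) (W : lmodType K)
    (phi : achain X Y -> W) : Prop :=
  forall (X1 X2 : aobj C) (p : achain X X1) (q : achain X2 Y)
         (k : K) (a a' : ahom X1 X2),
    phi (ccat p (CCons (k *: a + a') q)) =
    k *: phi (ccat p (CCons a q)) + phi (ccat p (CCons a' q)).

Record is_ainf_category (C : ainf_data) : Prop := IsAInfCategory {
  ainf_grading : forall X Y : aobj C, is_grading (@adeg C X Y);
  ainf_multilinear : forall X Y : aobj C, is_multilinear (@aop C X Y);
  ainf_degree : forall (X Y : aobj C) (c : achain X Y) (ds : seq int),
    (0 < csize c)%N -> homogeneous c ds ->
    sdeg (\sum_(d <- ds) d + 1) (aop c);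
  ainf_relation : forall (X Y : aobj C) (c : achain X Y) (ds : seq int),
    (0 < csize c)%N -> homogeneous c ds ->
    \sum_(1 <= l < (csize c).+1) \sum_(0 <= j < ((csize c).+1 - l)%N)
      (-1) ^ (\sum_(d <- take j ds) d) *: aop (cinsert (@aop C) c j l) = 0
}.

Record ainf_category := AInfCategory {
  ainf_category_data :> ainf_data;
  ainf_categoryP : is_ainf_category ainf_category_data
}.

Record functor_data (D C : ainf_data) := FunctorData {
  fobj : aobj D -> aobj C;
  fmor : forall X Y, achain X Y -> ahom (fobj X) (fobj Y)
}.

Record is_ainf_functor (D C : ainf_category) (F : functor_data D C) : Prop :=
  IsAInfFunctor {
  functor_multilinear : forall X Y : aobj D, is_multilinear (@fmor D C F X Y);
  functor_degree : forall (X Y : aobj D) (c : achain X Y) (ds : seq int),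
    (0 < csize c)%N -> homogeneous c ds ->
    sdeg (\sum_(d <- ds) d) (fmor F c);
  functor_relation : forall (X Y : aobj D) (c : achain X Y) (ds : seq int),
    (0 < csize c)%N -> homogeneous c ds ->
    \sum_(1 <= i < (csize c).+1)
      \sum_(js : i.-tuple 'I_(csize c).+1
             | is_composition (csize c) (map val js))
        aop (cblocks (@fmor D C F) (map val js) c) =
    \sum_(1 <= l < (csize c).+1) \sum_(0 <= j < ((csize c).+1 - l)%N)
      (-1) ^ (\sum_(d <- take j ds) d) *: fmor F (cinsert (@aop D) c j l)
}.

End AInfinity.

(* m x n matrices whose (i, j) entry lies in V i j *)
Section DepMatrix.
Variables (K : fieldType) (m n : nat) (V : 'I_m -> 'I_n -> lmodType K).

Definition depmx : Type := {dffun forall ij : 'I_m * 'I_n, V ij.1 ij.2}.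

HB.instance Definition _ := Choice.copy depmx
  {dffun forall ij : 'I_m * 'I_n, V ij.1 ij.2}.

Definition mxentry (M : depmx) (i : 'I_m) (j : 'I_n) : V i j := M (i, j).

Definition mkmx (E : forall i j, V i j) : depmx :=
  [ffun ij : 'I_m * 'I_n => E ij.1 ij.2].

Lemma mxentryE E i j : mxentry (mkmx E) i j = E i j.
Proof. by rewrite /mxentry ffunE. Qed.

Lemma depmxP (M N : depmx) :
  (forall i j, mxentry M i j = mxentry N i j) -> M = N.
Proof. by move=> eqMN; apply/ffunP => -[i j]; exact: eqMN. Qed.

Let add (M N : depmx) := mkmx (fun i j => mxentry M i j + mxentry N i j).
Let opp (M : depmx) := mkmx (fun i j => - mxentry M i j).
Let scale (k : K) (M : depmx) := mkmx (fun i j => k *: mxentry M i j).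

Fact depmx_addA : associative add.
Proof. by move=> x y z; apply: depmxP => i j; rewrite !mxentryE addrA. Qed.
Fact depmx_addC : commutative add.
Proof. by move=> x y; apply: depmxP => i j; rewrite !mxentryE addrC. Qed.
Fact depmx_add0 : left_id (mkmx (fun i j => 0)) add.
Proof. by move=> x; apply: depmxP => i j; rewrite !mxentryE add0r. Qed.
Fact depmx_addN : left_inverse (mkmx (fun i j => 0)) opp add.
Proof. by move=> x; apply: depmxP => i j; rewrite !mxentryE addNr. Qed.

HB.instance Definition _ :=
  GRing.isZmodule.Build depmx depmx_addA depmx_addC depmx_add0 depmx_addN.

Fact depmx_scaleA k l M : scale k (scale l M) = scale (k * l) M.
Proof. by apply: depmxP => i j; rewrite !mxentryE scalerA. Qed.
Fact depmx_scale1 : left_id 1 scale.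
Proof. by move=> x; apply: depmxP => i j; rewrite !mxentryE scale1r. Qed.
Fact depmx_scaleDr : right_distributive scale +%R.
Proof. by move=> k x y; apply: depmxP => i j; rewrite !mxentryE scalerDr. Qed.
Fact depmx_scaleDl v : {morph scale^~ v : k l / k + l}.
Proof. by move=> k l; apply: depmxP => i j; rewrite !mxentryE scalerDl. Qed.

HB.instance Definition _ := GRing.Zmodule_isLmodule.Build K depmx
  depmx_scaleA depmx_scale1 depmx_scaleDr depmx_scaleDl.

Lemma mxentryD M N i j : mxentry (M + N) i j = mxentry M i j + mxentry N i j.
Proof. exact: mxentryE. Qed.
Lemma mxentryZ k M i j : mxentry (k *: M) i j = k *: mxentry M i j.
Proof. exact: mxentryE. Qed.
Lemma mxentry0 i j : mxentry 0 i j = 0.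
Proof. exact: mxentryE. Qed.
Lemma mxentry_sum (I : Type) (r : seq I) (P : pred I) (M : I -> depmx) i j :
  mxentry (\sum_(x <- r | P x) M x) i j = \sum_(x <- r | P x) mxentry (M x) i j.
Proof.
by apply: (big_morph (fun M => mxentry M i j)) => [x y|];
  [exact: mxentryD | exact: mxentry0].
Qed.

End DepMatrix.

Inductive enlargement_kind := Enl1 | Enl2.

(* X_1[r_1] + ... + X_l[r_l], with the zero object as the case l = 0 *)
Record fsum (O : Type) := FSum {
  fs_len : nat;
  fs_obj : 'I_fs_len -> O;
  fs_shift : 'I_fs_len -> int
}.

Arguments fs_obj {O} f i.
Arguments fs_shift {O} f i.

Section Enlargement.
Variable K : fieldType.

Section Homs.
Variable C : ainf_data K.

(* The prime map alpha |-> alpha' is the identity on entries. *)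
Definition enl_hom (S T : fsum (aobj C)) : lmodType K :=
  depmx (fun i j => ahom (fs_obj S i) (fs_obj T j)).

Definition enl_deg (S T : fsum (aobj C)) (r : int) (M : enl_hom S T) : Prop :=
  forall i j, adeg (r + fs_shift T j - fs_shift S i) (mxentry M i j).

Definition enl_chain := chain enl_hom.

(* For a chain (M_1, ..., M_k) of matrices with M_t : S_t -> S_(t+1), the sum
   of F [:: r_1; ...; r_k] (entries of M_1, ..., M_k at (i_1, i_2), ...,
   (i_k, i_(k+1))) over all i_2, ..., i_k, where i_1 = i, i_(k+1) = j and r_t is
   the shift of the summand i_t of S_t. *)
Fixpoint path_sum (W : lmodType K) (S T : fsum (aobj C)) (c : enl_chain S T) :
    forall (i : 'I_(fs_len S)) (j : 'I_(fs_len T)),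
    (seq int -> achain (fs_obj S i) (fs_obj T j) -> W) -> W :=
  match c with
  | CNil S0 => fun i j F =>
    match i =P j with
    | ReflectT e =>
      match e in _ = j0
        return (seq int -> achain (fs_obj S0 i) (fs_obj S0 j0) -> W) -> W with
      | erefl => fun F0 => F0 [::] (CNil (fs_obj S0 i))
      end F
    | ReflectF _ => 0
    end
  | CCons S0 S1 T0 M c' => fun i j F =>
    \sum_(k < fs_len S1) @path_sum W S1 T0 c' k j
      (fun rs p => F (fs_shift S0 i :: rs) (CCons (mxentry M i k) p))
  end.

Lemma path_sum1 (W : lmodType K) (S T : fsum (aobj C)) (M : enl_hom S T) i j
    (F : seq int -> achain (fs_obj S i) (fs_obj T j) -> W) :
  path_sum (CCons M (CNil T)) F =
  F [:: fs_shift S i] (CCons (mxentry M i j) (CNil _)).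
Proof.
rewrite /= (bigD1 j) //= big1 ?addr0 => [|k kj].
  by case: eqP => // e; rewrite (eq_axiomK e).
by case: eqP => // e; rewrite e eqxx in kj.
Qed.

End Homs.

(* the exponent of the sign of the operation b_k^(a), for rs = [:: r_1; ...; r_k] *)
Definition enl_op_sign (a : enlargement_kind) (rs : seq int) : int :=
  if a is Enl1 then head 0 rs else \sum_(r <- rs) r.

Definition enl_data (a : enlargement_kind) (C : ainf_data K) : ainf_data K :=
  @AInfData K (fsum (aobj C)) (@enl_hom C) (@enl_deg C)
    (fun S T c => mkmx (fun i j =>
       path_sum c (fun rs p => (-1) ^ (enl_op_sign a rs) *: aop p))).

End Enlargement.

Lemma csize_drop (O : Type) (H : O -> O -> Type) X Y (c : chain H X Y) j :
  csize (cdrop c j) = (csize c - j)%N.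
Proof. by elim: c j => [X0|X0 Y0 Z0 a c IH] [|j] //=. Qed.

Section PathSumTheory.
Variables (K : fieldType) (C : ainf_data K).
Implicit Types (S T U : fsum (aobj C)).

Inductive is_path : forall S T, enl_chain S T ->
    forall (i : 'I_(fs_len S)) (j : 'I_(fs_len T)),
    seq int -> achain (fs_obj S i) (fs_obj T j) -> Prop :=
| IsPathNil S (i : 'I_(fs_len S)) :
    is_path (CNil S) (j := i) [::] (CNil (fs_obj S i))
| IsPathCons S T U (M : enl_hom S T) (c : enl_chain T U)
    (i : 'I_(fs_len S)) (k : 'I_(fs_len T)) (j : 'I_(fs_len U)) rs
    (p : achain (fs_obj T k) (fs_obj U j)) :
    is_path c rs p ->
    is_path (CCons M c) (fs_shift S i :: rs) (CCons (mxentry M i k) p).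

Lemma path_sum_ext (W : lmodType K) S T (c : enl_chain S T) i j
    (F G : seq int -> achain (fs_obj S i) (fs_obj T j) -> W) :
  (forall rs p, is_path c rs p -> F rs p = G rs p) ->
  path_sum c F = path_sum c G.
Proof.
elim: c i j F G => [S0|S0 T0 U0 M c IH] i j F G FG /=.
  by case: eqP => // e; case: _ / e F G FG => F G; apply; constructor.
by apply: eq_bigr => k _; apply: IH => rs p cp; apply: FG; constructor.
Qed.

Lemma path_sum_closed (W : lmodType K) (P : W -> Prop) S T (c : enl_chain S T)
    i j (F : seq int -> achain (fs_obj S i) (fs_obj T j) -> W) :
  P 0 -> (forall x y, P x -> P y -> P (x + y)) ->
  (forall rs p, is_path c rs p -> P (F rs p)) -> P (path_sum c F).
Proof.
move=> P0 PD; elim: c i j F => [S0|S0 T0 U0 M c IH] i j F PF /=.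
  by case: eqP => // e; case: _ / e F PF => F; apply; constructor.
by apply: big_ind => // k _; apply: IH => rs p cp; apply: PF; constructor.
Qed.

Lemma path_sum0 (W : lmodType K) S T (c : enl_chain S T) i j :
  path_sum c (fun _ (_ : achain (fs_obj S i) (fs_obj T j)) => 0 : W) = 0.
Proof. by apply: (path_sum_closed (P := fun x => x = 0)) => // x y -> ->; rewrite addr0. Qed.

Lemma path_sum_lin (W W' : lmodType K) (g : W -> W') S T (c : enl_chain S T) i j
    (F : seq int -> achain (fs_obj S i) (fs_obj T j) -> W) :
  (forall k x y, g (k *: x + y) = k *: g x + g y) ->
  g (path_sum c F) = path_sum c (fun rs p => g (F rs p)).
Proof.
move=> glin; have gD x y : g (x + y) = g x + g y.
  by have := glin 1 x y; rewrite !scale1r.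
have g0 : g 0 = 0 by apply: (addrI (g 0)); rewrite -gD !addr0.
elim: c i j F => [S0|S0 T0 U0 M c IH] i j F /=.
  by case: eqP => // e; case: _ / e F.
by rewrite (big_morph g gD g0); apply: eq_bigr => k _; exact: IH.
Qed.

Lemma path_sumZD (W : lmodType K) S T (c : enl_chain S T) i j
    (F G : seq int -> achain (fs_obj S i) (fs_obj T j) -> W) k :
  path_sum c (fun rs p => k *: F rs p + G rs p) =
  k *: path_sum c F + path_sum c G.
Proof.
elim: c i j F G => [S0|S0 T0 U0 M c IH] i j F G /=.
  by case: eqP => [e|_]; [case: _ / e F G | rewrite scaler0 addr0].
by rewrite scaler_sumr -big_split; apply: eq_bigr => l _; exact: IH.
Qed.

Lemma path_sumD (W : lmodType K) S T (c : enl_chain S T) i j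
    (F G : seq int -> achain (fs_obj S i) (fs_obj T j) -> W) :
  path_sum c (fun rs p => F rs p + G rs p) = path_sum c F + path_sum c G.
Proof.
rewrite -[path_sum c F]scale1r -path_sumZD; apply: path_sum_ext => rs p _.
by rewrite scale1r.
Qed.

Lemma path_sum_sum (W : lmodType K) S T (c : enl_chain S T) i j
    (I : Type) (r : seq I) (P : pred I)
    (F : I -> seq int -> achain (fs_obj S i) (fs_obj T j) -> W) :
  path_sum c (fun rs p => \sum_(x <- r | P x) F x rs p) =
  \sum_(x <- r | P x) path_sum c (F x).
Proof.
elim: r => [|x r IH].
  rewrite big_nil -[RHS](path_sum0 W c i j).
  by apply: path_sum_ext => rs p _; rewrite big_nil.
rewrite big_cons; case: ifP => Px; rewrite -IH -?path_sumD;
  by apply: path_sum_ext => rs p _; rewrite big_cons Px.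
Qed.

Lemma path_sum_exchange (W : lmodType K) S T (c : enl_chain S T) i j
    S' T' (c' : enl_chain S' T') i' j'
    (F : seq int -> achain (fs_obj S i) (fs_obj T j) ->
         seq int -> achain (fs_obj S' i') (fs_obj T' j') -> W) :
  path_sum c (fun rs p => path_sum c' (F rs p)) =
  path_sum c' (fun rs' p' => path_sum c (fun rs p => F rs p rs' p')).
Proof.
elim: c i j F => [S0|S0 T0 U0 M c IH] i j F /=.
  by case: eqP => [e|_]; [case: _ / e F | rewrite path_sum0].
by rewrite path_sum_sum; apply: eq_bigr => k _; rewrite -IH.
Qed.

Lemma path_sum_nil (W : lmodType K) S (i : 'I_(fs_len S))
    (F : forall k, seq int -> achain (fs_obj S i) (fs_obj S k) -> W) :
  \sum_k path_sum (CNil S) (F k) = F i [::] (CNil _).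
Proof.
rewrite /= (bigD1 i) //= big1 ?addr0 => [|k ki].
  by case: eqP => // e; rewrite (eq_axiomK e).
by case: eqP => // e; rewrite e eqxx in ki.
Qed.

Lemma path_sum_cat (W : lmodType K) S T U (c : enl_chain S T)
    (c' : enl_chain T U) i j
    (F : seq int -> achain (fs_obj S i) (fs_obj U j) -> W) :
  path_sum (ccat c c') F =
  \sum_k path_sum c (j := k) (fun rs p =>
    path_sum c' (fun rs' p' => F (rs ++ rs') (ccat p p'))).
Proof.
elim: c c' i j F => [S0|S0 T0 U0 M c IH] c' i j F.
  by rewrite path_sum_nil.
rewrite /= exchange_big; apply: eq_bigr => k _; exact: IH.
Qed.

Lemma path_sum_split (W : lmodType K) S T (c : enl_chain S T) l i j
    (G : seq int -> seq int -> forall Y : aobj C,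
         achain (fs_obj S i) Y -> achain Y (fs_obj T j) -> W) :
  path_sum c (fun rs p => G (take l rs) (drop l rs) _ (ctake p l) (cdrop p l)) =
  \sum_k path_sum (ctake c l) (j := k) (fun rs p =>
    path_sum (cdrop c l) (fun rs' p' => G rs rs' _ p p')).
Proof.
elim: c l i j G => [S0|S0 T0 U0 M c IH] l i j G.
  rewrite /= (path_sum_nil (fun k rs p => path_sum (CNil S0) (fun rs' p' => G rs rs' _ p p'))).
  by rewrite /=; case: eqP => // e; case: _ / e G.
case: l => [|l].
  rewrite (path_sum_nil (fun k rs p => path_sum (CCons M c) (fun rs' p' => G rs rs' _ p p'))).
  by apply: eq_bigr => k _; apply: path_sum_ext.
rewrite /= exchange_big; apply: eq_bigr => k _.
exact: (IH l k j (fun rs1 rs2 Y p1 p2 => G (fs_shift S0 i :: rs1) rs2 Y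
  (CCons (mxentry M i k) p1) p2)).
Qed.

Fixpoint unshift (ds rs : seq int) (e : int) : seq int :=
  match ds, rs with
  | d :: ds', r :: rs' => (d + head e rs' - r) :: unshift ds' rs' e
  | _, _ => [::]
  end.

Lemma path_size S T (c : enl_chain S T) i j rs
    (p : achain (fs_obj S i) (fs_obj T j)) :
  is_path c rs p -> csize p = csize c /\ size rs = csize c.
Proof. by elim=> //= {}S {}T U M {}c {}i k {}j {}rs {}p _ [-> ->]. Qed.

Lemma path_head S T (c : enl_chain S T) i j rs
    (p : achain (fs_obj S i) (fs_obj T j)) :
  is_path c rs p -> head (fs_shift T j) rs = fs_shift S i.
Proof. by case. Qed.

Lemma path_homogeneous a S T (c : enl_chain S T) i j rs
    (p : achain (fs_obj S i) (fs_obj T j)) ds :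
  is_path c rs p -> @homogeneous K (enl_data a C) S T c ds ->
  size ds = csize c /\ homogeneous p (unshift ds rs (fs_shift T j)).
Proof.
move=> cp; elim: cp ds => [{}S {}i|{}S {}T U M {}c {}i k {}j {}rs {}p cp IH] [|d ds] //=.
case=> Md /IH[-> hp]; split=> //; split=> //.
have:= Md i k; rewrite /sdeg (path_head cp).
by rewrite -!addrA [1 + _]addrC -!addrA.
Qed.

Lemma unshift_size ds rs e : size ds = size rs -> size (unshift ds rs e) = size rs.
Proof. by elim: ds rs => [|d ds IH] [|r rs] //= [/IH->]. Qed.

Lemma sum_take_unshift j ds rs e : size ds = size rs ->
  \sum_(d <- take j (unshift ds rs e)) d =
  \sum_(d <- take j ds) d + head e (drop j rs) - head e rs.
Proof.
elim: ds rs j => [|d ds IH] [|r rs] [|j] //=; rewrite ?big_nil ?add0r ?subrr //.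
by case=> sz; rewrite !big_cons IH //; ring.
Qed.

Lemma sum_unshift ds rs e : size ds = size rs ->
  \sum_(d <- unshift ds rs e) d = \sum_(d <- ds) d + e - head e rs.
Proof.
move=> sz; have := sum_take_unshift (size rs) e sz.
by rewrite -{1}(unshift_size e sz) take_size -sz take_size sz drop_size.
Qed.

Lemma multilinearZ (W : lmodType K) (X Y : aobj C) (phi : achain X Y -> W)
    X1 X2 (p : achain X X1) (q : achain X2 Y) k (x : ahom X1 X2) :
  is_multilinear phi ->
  phi (ccat p (CCons (k *: x) q)) = k *: phi (ccat p (CCons x q)).
Proof.
move=> mphi; have := mphi _ _ p q 1 0 0; rewrite !scale1r addr0 => phi0.
have {}phi0 : phi (ccat p (CCons (0 : ahom X1 X2) q)) = 0.
  by apply: (addrI (phi (ccat p (CCons (0 : ahom X1 X2) q)))); rewrite addr0 -phi0.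
by have := mphi _ _ p q k x 0; rewrite phi0 !addr0.
Qed.

Lemma path_multilinear a (W : lmodType K) S T i j (sg : seq int -> K)
    (phi : achain (fs_obj S i) (fs_obj T j) -> W) :
  is_multilinear phi ->
  @is_multilinear K (enl_data a C) S T W
    (fun c => path_sum c (fun rs p => sg rs *: phi p)).
Proof.
move=> mphi X1 X2 p q k M M'; rewrite !path_sum_cat.
rewrite scaler_sumr -big_split; apply: eq_bigr => x _ /=.
rewrite -path_sumZD; apply: path_sum_ext => rs p1 _ /=.
rewrite scaler_sumr -big_split; apply: eq_bigr => y _ /=.
rewrite -path_sumZD; apply: path_sum_ext => rs' p2 _ /=.
rewrite mxentryD mxentryZ mphi scalerDr !scalerA.
by rewrite [k * _]mulrC.
Qed.

Lemma mkmx_multilinear a S T m n (V : 'I_m -> 'I_n -> lmodType K)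
    (phi : forall i j, enl_chain S T -> V i j) :
  (forall i j, @is_multilinear K (enl_data a C) S T (V i j) (phi i j)) ->
  @is_multilinear K (enl_data a C) S T (depmx V)
    (fun c => mkmx (fun i j => phi i j c)).
Proof.
move=> mphi X1 X2 p q k M M'; apply: depmxP => i j.
by rewrite mxentryD mxentryZ !mxentryE mphi.
Qed.

Lemma path_sum_insert a (W : lmodType K) S T i0 j0 (c : enl_chain S T) j l
    (sg : seq int -> K) (phi : achain (fs_obj S i0) (fs_obj T j0) -> W) :
  is_multilinear phi -> (0 < l)%N -> (j + l <= csize c)%N ->
  path_sum (cinsert (@aop K (enl_data a C)) c j l) (fun rs p => sg rs *: phi p)
  = path_sum c (fun rs p =>
      (sg (take j rs ++ head 0 (drop j rs) :: drop l (drop j rs)) *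
       (-1) ^ (enl_op_sign a (take l (drop j rs)))) *:
      phi (cinsert (@aop K C) p j l)).
Proof.
move=> mphi l0 jl; rewrite /cinsert path_sum_cat.
rewrite (path_sum_split c j (fun rs1 rs2 Y p1 p2 =>
  (sg (rs1 ++ head 0 rs2 :: drop l rs2) *
    (-1) ^ enl_op_sign a (take l rs2)) *:
   phi (ccat p1 (CCons (aop (ctake p2 l)) (cdrop p2 l))))).
apply: eq_bigr => k _; apply: path_sum_ext => rs1 p1 _ /=.
transitivity (path_sum (cdrop c j) (fun rs2
  (p2 : achain (fs_obj (cobj c j) k) (fs_obj T j0)) =>
  (sg (rs1 ++ fs_shift (cobj c j) k :: drop l rs2) *
    (-1) ^ enl_op_sign a (take l rs2)) *:
   phi (ccat p1 (CCons (aop (ctake p2 l)) (cdrop p2 l))))); last first.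
  apply: path_sum_ext => rs2 p2 cp; have [_ sz] := path_size cp.
  rewrite -(path_head cp); case: rs2 sz {cp} => //= sz.
  have := csize_drop c j; rewrite -sz; lia.
rewrite (path_sum_split (cdrop c j) l (fun rs2 rs3 Y p2 p3 =>
  (sg (rs1 ++ fs_shift (cobj c j) k :: rs3) * (-1) ^ enl_op_sign a rs2) *:
   phi (ccat p1 (CCons (aop p2) p3)))).
apply: eq_bigr => k' _; rewrite path_sum_exchange.
apply: path_sum_ext => rs3 p3 _.
rewrite mxentryE.
rewrite (path_sum_lin (g := fun x => sg _ *: phi (ccat p1 (CCons x p3)))).
  apply: path_sum_ext => rs2 p2 _.
  rewrite -scalerA; congr (_ *: _).
  by rewrite multilinearZ.
by move=> k0 x y; rewrite mphi scalerDr !scalerA mulrC.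
Qed.

End PathSumTheory.

Section EnlargementCategory.
Variable K : fieldType.

Lemma enl_grading (C : ainf_data K) (S T : fsum (aobj C)) :
  (forall X Y : aobj C, is_grading (@adeg K C X Y)) ->
  is_grading (@enl_deg K C S T).
Proof.
move=> grC; pose s i j := fs_shift T j - fs_shift S i.
split=> [r i j|r k x y Mx My i j|x|rs x_ urs hx x0 r rin].
- by rewrite mxentry0; apply: grading0.
- by rewrite mxentryD mxentryZ; apply: gradingP.
- have /fin_all_exists[rs] := fun ij : 'I_(fs_len S) * 'I_(fs_len T) =>
    grading_span (grC (fs_obj S ij.1) (fs_obj T ij.2)) (mxentry x ij.1 ij.2).
  case/fin_all_exists => x_ hx.
  pose R := undup (flatten [seq [seq q - s ij.1 ij.2 | q <- rs ij]
                           | ij : 'I_(fs_len S) * 'I_(fs_len T)]).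
  exists R, (fun r => mkmx (fun i j => if r + s i j \in rs (i, j)
                                       then x_ (i, j) (r + s i j) else 0)).
  split; first exact: undup_uniq.
    move=> r i j; rewrite mxentryE -addrA -/(s i j).
    by case: ifP => _; [case: (hx (i, j)) | apply: grading0].
  apply: depmxP => i j; rewrite mxentry_sum.
  case: (hx (i, j)) => /= urs _ ->.
  under [RHS]eq_bigr do rewrite mxentryE.
  rewrite -big_mkcond -[RHS]big_filter.
  rewrite -(big_map (fun r => r + s i j) xpredT (x_ (i, j))).
  apply: perm_big; apply: uniq_perm => //.
    rewrite map_inj_uniq ?filter_uniq ?undup_uniq //; exact: addIr.
  move=> q; apply/idP/mapP => [qin|[r] + ->]; last first.
    by rewrite mem_filter => /andP[].
  exists (q - s i j); last by rewrite subrK.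
  rewrite mem_filter subrK qin mem_undup /=.
  apply/flatten_mapP; exists (i, j); first by rewrite mem_enum.
  by apply/mapP; exists q.
- apply: depmxP => i j; rewrite mxentry0.
  have inj : injective (fun r => r + s i j) by exact: addIr.
  pose y_ (q : int) := mxentry (x_ (q - s i j)) i j.
  have hy q : adeg q (y_ q).
    have := hx (q - s i j) i j; rewrite -addrA -/(s i j) subrK; exact.
  have y0 : \sum_(q <- [seq r + s i j | r <- rs]) y_ q = 0.
    rewrite big_map; transitivity (mxentry (\sum_(r <- rs) x_ r) i j).
      rewrite mxentry_sum; by apply: eq_bigr => q _; rewrite /y_ addrK.
    by rewrite x0 mxentry0.
  have urs' : uniq [seq r + s i j | r <- rs] by rewrite map_inj_uniq.
  have := grading_free (grC _ _) urs' hy y0.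
  have rin' : r + s i j \in [seq r + s i j | r <- rs] by apply/mapP; exists r.
  by move/(_ _ rin'); rewrite /y_ addrK.
Qed.

Lemma signP (x y z : int) : x = y + 2 * z -> (-1) ^ x = (-1) ^ y :> K.
Proof.
by move=> ->; rewrite expfzDr ?oppr_eq0 ?oner_eq0 // -exprz_exp (_ : (-1) ^ 2 = 1 :> K) ?exp1rz ?mulr1 // -exprnP sqrrN expr1n.
Qed.

Lemma signD (x y : int) : (-1) ^ x * (-1) ^ y = (-1) ^ (x + y) :> K.
Proof. by rewrite expfzDr // oppr_eq0 oner_eq0. Qed.

Lemma gradingZ (V : lmodType K) (gr : int -> V -> Prop) r k x :
  is_grading gr -> gr r x -> gr r (k *: x).
Proof.
by move=> h hx; rewrite -[k *: x]addr0; apply: gradingP => //; apply: grading0.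
Qed.

Lemma gradingD (V : lmodType K) (gr : int -> V -> Prop) r x y :
  is_grading gr -> gr r x -> gr r y -> gr r (x + y).
Proof. by move=> h hx hy; rewrite -[x]scale1r; apply: gradingP. Qed.

Lemma big_split_take (ds : seq int) j :
  \sum_(d <- ds) d = \sum_(d <- take j ds) d + \sum_(d <- drop j ds) d.
Proof. by rewrite -big_cat cat_take_drop. Qed.

Lemma sum_head_behead (rs : seq int) :
  \sum_(r <- rs) r = head 0 rs + \sum_(r <- behead rs) r.
Proof. by case: rs => [|r rs]; rewrite ?big_nil ?big_cons ?addr0. Qed.

Lemma enl_path_degree a (C : ainf_data K) (S T : fsum (aobj C)) (W : ainf_data K)
    (g : aobj C -> aobj W) (phi : forall X Y : aobj C, achain X Y -> ahom (g X) (g Y))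
    (e : int) (sg : seq int -> K) (c : enl_chain S T) ds :
  (forall X Y : aobj W, is_grading (@adeg K W X Y)) ->
  (forall (X Y : aobj C) (c : achain X Y) ds, (0 < csize c)%N -> homogeneous c ds ->
     sdeg (\sum_(d <- ds) d + e) (phi X Y c)) ->
  (0 < csize c)%N -> @homogeneous K (enl_data a C) S T c ds ->
  forall i j, adeg (\sum_(d <- ds) d + e + 1 + fs_shift T j - fs_shift S i)
    (path_sum c (fun rs (p : achain (fs_obj S i) (fs_obj T j)) => sg rs *: phi _ _ p)).
Proof.
move=> grW dphi c0 hc i j; apply: path_sum_closed.
- exact: grading0.
- by move=> x y; exact: gradingD.
move=> rs p cp; apply: gradingZ => //.
have [sp sr] := path_size cp; have [sd hp] := path_homogeneous cp hc.
have := dphi _ _ p _ _ hp; rewrite sp => /(_ c0).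
rewrite sum_unshift ?sd // (path_head cp) /sdeg.
by congr (adeg _ _); ring.
Qed.

Theorem enl_is_ainf_category a (C : ainf_data K) :
  is_ainf_category C -> is_ainf_category (enl_data a C).
Proof.
case=> grC mC dC rC; split.
- by move=> S T; exact: enl_grading.
- move=> S T; apply: mkmx_multilinear => i j; apply: path_multilinear; exact: mC.
- move=> S T c ds c0 hc i j; rewrite mxentryE.
  exact: (enl_path_degree (phi := @aop K C) _ grC _ c0 hc).
move=> S T c ds c0 hc; apply: depmxP => i0 j0.
pose kap rs : int := if a is Enl1 then 0 else head 0 rs + \sum_(r <- rs) r.
transitivity (path_sum c (fun rs (p : achain (fs_obj S i0) (fs_obj T j0)) =>
  (-1) ^ (kap rs) *:
  (\sum_(1 <= l < (csize p).+1) \sum_(0 <= j < ((csize p).+1 - l)%N)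
     (-1) ^ (\sum_(d <- take j (unshift ds rs (fs_shift T j0))) d) *:
       aop (cinsert (@aop K C) p j l)))); last first.
  rewrite mxentry0 -[RHS](path_sum0 _ c i0 j0); apply: path_sum_ext => rs p cp.
  have [sp sr] := path_size cp; have [sd hp] := path_homogeneous cp hc.
  by rewrite rC ?scaler0 // sp.
transitivity (path_sum c (fun rs (p : achain (fs_obj S i0) (fs_obj T j0)) =>
  (\sum_(1 <= l < (csize c).+1) \sum_(0 <= j < ((csize c).+1 - l)%N)
    (-1) ^ (kap rs + \sum_(d <- take j (unshift ds rs (fs_shift T j0))) d) *:
       aop (cinsert (@aop K C) p j l)))); last first.
  apply: path_sum_ext => rs p cp; have [sp _] := path_size cp.
  rewrite sp scaler_sumr; apply: eq_bigr => l _.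
  rewrite scaler_sumr; apply: eq_bigr => j _.
  by rewrite scalerA signD.
rewrite mxentry_sum path_sum_sum; apply: eq_big_nat => l l1.
rewrite mxentry_sum path_sum_sum; apply: eq_big_nat => j j1.
have jl : (j + l <= csize c)%N by lia.
have l0 : (0 < l)%N by case/andP: l1.
have jn : (j < csize c)%N by apply: leq_trans jl; rewrite -addn1 leq_add2l.
rewrite mxentryZ mxentryE.
rewrite (path_sum_insert a (fun rs => (-1) ^ enl_op_sign a rs)
  (mC (fs_obj S i0) (fs_obj T j0)) l0 jl).
rewrite (path_sum_lin (g := fun x => _ *: x)); last first.
  by move=> k x y; rewrite scalerDr !scalerA mulrC.
apply: path_sum_ext => rs p cp.
have [sp sr] := path_size cp; have [sd hp] := path_homogeneous cp hc.
rewrite scalerA !signD; congr (_ *: _).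
rewrite sum_take_unshift ?sd // /kap /enl_op_sign.
have hd : head (fs_shift T j0) (drop j rs) = head 0 (drop j rs).
  have : (0 < size (drop j rs))%N by rewrite size_drop sr subn_gt0.
  by case: (drop j rs).
have hr : head (fs_shift T j0) rs = head 0 rs.
  by move: c0; rewrite -sr; case: (rs).
rewrite hd hr.
have hl : head 0 (take l (drop j rs)) = head 0 (drop j rs).
  by case: (drop j rs) => //; case: (l) l0.
have hj : head 0 (take j rs ++ head 0 (drop j rs) :: drop l (drop j rs)) = head 0 rs.
  by case: (rs) (j) => [|r rs'] [|j'].
rewrite hl hj big_cat big_cons (big_split_take rs j) (big_split_take (drop j rs) l) /=.
set A := \sum_(_ <- take j ds) _; set B := \sum_(_ <- take j rs) _.
set E := \sum_(_ <- take l _) _; set G := \sum_(_ <- drop l _) _.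
move: (head 0 rs) (head 0 (drop j rs)) => h h'.
by case: (a); [apply: (signP (z := h)) | apply: (signP (z := 0))]; ring.
Qed.

Definition enlargement (a : enlargement_kind) (C : ainf_category K) :
    ainf_category K :=
  AInfCategory (enl_is_ainf_category a (ainf_categoryP C)).

End EnlargementCategory.

Section EnlargementFunctor.
Variable K : fieldType.

(* For a = 1 there is no sign.  For a = 2 the components carry the sign
   (-1)^(r_2 + ... + r_k), without which the functor relation fails: with
   n = 2, the terms b_1(f_2(a_1, a_2)), f_2(b_1(a_1), a_2), f_2(a_1, b_1(a_2))
   would come with the sign (-1)^r_1, but b_2(f_1(a_1), f_1(a_2)) and
   f_1(b_2(a_1, a_2)) with (-1)^(r_1 + r_2). *)
Definition enl_fun_sign (a : enlargement_kind) (rs : seq int) : int :=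
  if a is Enl1 then 0 else \sum_(r <- behead rs) r.

Definition enl_functor (a : enlargement_kind) (D C : ainf_data K)
    (F : functor_data D C) : functor_data (enl_data a D) (enl_data a C) :=
  @FunctorData K (enl_data a D) (enl_data a C)
    (fun S => FSum (fun i => fobj F (fs_obj S i)) (fs_shift S))
    (fun S T c => mkmx (fun i j =>
       path_sum c (fun rs p => (-1) ^ (enl_fun_sign a rs) *: fmor F p))).

End EnlargementFunctor.

(* Main.v *)
(* Fix a path of summands with shifts r_1, ..., r_k, and let s be the exponent
   of the sign of b_k^(a) on it: r_1 for a = 1, r_1 + ... + r_k for a = 2.  The
   signs of f^(a), of b^(a) and of the shifted degrees multiply to (-1)^s in
   every term of the relation for f^(a), on both sides.  So this relation is the
   sum over all paths of (-1)^s times the relation for f on the entries. *)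

Require Import Defs.
From mathcomp Require Import all_boot all_order all_algebra.
From mathcomp Require Import zify ring.

Set Implicit Arguments.
Unset Strict Implicit.
Unset Printing Implicit Defensive.

Import GRing.Theory.
Local Open Scope ring_scope.

(* The shifts at which the blocks start, i.e. those of the summands through which
   the images of the blocks pass; [e] is the shift of the final summand. *)
Fixpoint block_heads (e : int) (js : seq nat) (rs : seq int) : seq int :=
  head e rs ::
    (if js is j :: ((_ :: _) as js') then block_heads e js' (drop j rs)
     else [::]).

(** The exponent that the components of f^(a) contribute over all blocks. As in [cblocks], the last
    block is all that remains, whatever its entry in [js]. *)
Fixpoint block_sign (a : enlargement_kind) (js : seq nat) (rs : seq int) : int :=
  if js is j :: ((_ :: _) as js') then
    enl_fun_sign a (take j rs) + block_sign a js' (drop j rs)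
  else enl_fun_sign a rs.

Lemma block_sign_Enl1 js rs : block_sign Enl1 js rs = 0.
Proof. by elim: js rs => [|j [|j' js] IH] rs //=; rewrite add0r; exact: IH. Qed.

(** Each head is the first shift of its block and [enl_fun_sign] adds the other ones, so every shift
    is counted once. An empty block would contribute a spurious head. *)
Lemma block_sign_Enl2 e js rs :
  0%N \notin js -> sumn js = size rs -> (0 < size rs)%N ->
  \sum_(h <- block_heads e js rs) h + block_sign Enl2 js rs = \sum_(r <- rs) r.
Proof.
elim: js rs => [|j [|j' js] IH] [|r rs] //=.
  by rewrite big_cons big_nil addr0 big_cons.
rewrite inE negb_or eq_sym -lt0n => /andP[j0 js0] sz _.
case: j j0 sz => // j _ sz.
have sz' : (j' + sumn js = size (drop j rs))%N.
  by rewrite size_drop; lia.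
have d0 : (0 < size (drop j rs))%N.
  by move: js0; rewrite inE negb_or eq_sym -sz'; lia.
have := IH (drop j rs) js0 sz' d0.
rewrite /= !big_cons (big_split_take rs j) => <-; ring.
Qed.

(** This makes the sign independent of the composition [js], hence a common factor of the left side
    of the functor relation on a given path. *)
Lemma block_signE a e js rs :
  0%N \notin js -> sumn js = size rs -> (0 < size rs)%N ->
  enl_op_sign a (block_heads e js rs) + block_sign a js rs = enl_op_sign a rs.
Proof.
case: a => [_ _|]; last exact: block_sign_Enl2.
by rewrite block_sign_Enl1 addr0 /enl_op_sign; case: rs js => [|r rs] [|j js].
Qed.

Lemma multilinear_cons (K : fieldType) (C : ainf_data K) (W : lmodType K)
    (X Y Z : aobj C) (phi : achain X Z -> W) (x : ahom X Y) :
  is_multilinear phi -> is_multilinear (fun p : achain Y Z => phi (CCons x p)).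
Proof. by move=> mphi X1 X2 p; exact: (mphi _ _ (CCons x p)). Qed.

Section Blocks.
Variables (K : fieldType) (D C : ainf_data K) (a : enlargement_kind).
Variable F : functor_data D C.

(** Each entry of the image of a block is itself a sum over paths through that block. Multilinearity
    of [phi] pulls these sums out, and the paths through successive blocks concatenate to paths
    through [c]. *)
Lemma path_sum_blocks (W : lmodType K) js (S T : fsum (aobj D))
    (c : enl_chain S T) i j (sg : seq int -> K)
    (phi : achain (fobj F (fs_obj S i)) (fobj F (fs_obj T j)) -> W) :
  is_multilinear phi ->
  @path_sum K C W (fobj (enl_functor a F) S) (fobj (enl_functor a F) T)
    (cblocks (@fmor K _ _ (enl_functor a F)) js c) i j
    (fun rs p => sg rs *: phi p)
  = path_sum c (fun rs p =>
      (sg (block_heads (fs_shift T j) js rs) * (-1) ^ (block_sign a js rs)) *: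
      phi (cblocks (@fmor K D C F) js p)).
Proof.
(* The single-block case; it also covers [js = [::]], which [cblocks] treats alike. *)
have one (S' T' : fsum (aobj D)) (c' : enl_chain S' T') i' j' (sg' : seq int -> K)
    (phi' : achain (fobj F (fs_obj S' i')) (fobj F (fs_obj T' j')) -> W) :
    is_multilinear phi' ->
    @path_sum K C W (fobj (enl_functor a F) S') (fobj (enl_functor a F) T')
      (CCons (fmor (enl_functor a F) c') (CNil _)) i' j'
      (fun rs p => sg' rs *: phi' p)
    = path_sum c' (fun rs p => (sg' [:: head (fs_shift T' j') rs] *
        (-1) ^ (enl_fun_sign a rs)) *: phi' (CCons (fmor F p) (CNil _))).
  move=> mphi; rewrite path_sum1 mxentryE.
  rewrite (path_sum_lin (g := fun x => sg' _ *: phi' (CCons x (CNil _)))).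
    apply: path_sum_ext => rs p cp; rewrite (path_head cp) -scalerA.
    congr (_ *: _).
    exact: (@multilinearZ K C W _ _ phi' _ _ (CNil _) (CNil _)).
  move=> k x y; rewrite (mphi _ _ (CNil _) (CNil _)) /=.
  by rewrite scalerDr !scalerA mulrC.
elim: js S c i sg phi => [|n [|n' js] IH] S c i sg phi mphi; try exact: one.
set js' := n' :: js in IH *.
rewrite [cblocks _ _ _]/= -/js'.
(* The head of [rs] becomes the constant [fs_shift S i], so that the summand depends only on the two
   pieces of the path, as [path_sum_split] requires. *)
transitivity (path_sum c (fun rs (p : achain (fs_obj S i) (fs_obj T j)) =>
  (sg (fs_shift S i :: block_heads (fs_shift T j) js' (drop n rs)) *
   (-1) ^ (enl_fun_sign a (take n rs) + block_sign a js' (drop n rs))) *: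
  phi (CCons (fmor F (ctake p n)) (cblocks (@fmor K D C F) js' (cdrop p n))))); last first.
  by apply: path_sum_ext => rs p cp /=; rewrite (path_head cp).
rewrite (path_sum_split c n (fun rs1 rs2 Y p1 p2 =>
  (sg (fs_shift S i :: block_heads (fs_shift T j) js' rs2) *
   (-1) ^ (enl_fun_sign a rs1 + block_sign a js' rs2)) *:
  phi (CCons (fmor F p1) (cblocks (@fmor K D C F) js' p2)))).
apply: eq_bigr => k _.
(* With the tail summed outermost, the induction hypothesis applies to it while the entry [x] of the
   first block stays fixed; [x] is expanded afterwards. *)
rewrite [RHS]path_sum_exchange.
pose x : ahom (fobj F (fs_obj S i)) (fobj F (fs_obj (cobj c n) k)) :=
  mxentry (fmor (enl_functor a F) (ctake c n)) i k.
apply: etrans (IH _ (cdrop c n) k (fun rs => sg (fs_shift S i :: rs))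
  (fun p => phi (CCons x p)) (multilinear_cons x mphi)) _.
apply: path_sum_ext => rs2 p2 _; rewrite /x mxentryE.
rewrite (path_sum_lin (g := fun x => _ *: phi (CCons x _))).
  apply: path_sum_ext => rs1 p1 _.
  rewrite [_ + block_sign _ _ _]addrC -signD mulrA -[in RHS]scalerA.
  congr (_ *: _).
  exact: (@multilinearZ K C W _ _ phi _ _ (CNil _)).
move=> k0 y z; rewrite (mphi _ _ (CNil _)) /=.
by rewrite scalerDr !scalerA mulrC.
Qed.

End Blocks.

Theorem proposition3p3 (K : fieldType) (D C : ainf_category K)
    (a : enlargement_kind) (F : functor_data D C) (HF : is_ainf_functor F) :
  @is_ainf_functor K (enlargement a D) (enlargement a C) (enl_functor a F).
Proof.
case: HF => mF dF rF.
have [grC mC _ _] := ainf_categoryP C; split.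
- move=> S T; apply: mkmx_multilinear => i j; apply: path_multilinear; exact: mF.
- move=> S T c ds c0 hc i j; rewrite mxentryE.
  have dF0 X Y (c' : achain X Y) ds' : (0 < csize c')%N -> homogeneous c' ds' ->
      sdeg (\sum_(d <- ds') d + 0) (fmor F c').
    by rewrite addr0; exact: dF.
  by have := enl_path_degree (fun rs => (-1) ^ enl_fun_sign a rs) grC dF0 c0 hc i j;
    rewrite addr0.
move=> S T c ds c0 hc; apply: depmxP => i0 j0.
transitivity (path_sum c (fun rs (p : achain (fs_obj S i0) (fs_obj T j0)) =>
  (-1) ^ (enl_op_sign a rs) *:
  (\sum_(1 <= i < (csize p).+1)
      \sum_(js : i.-tuple 'I_(csize p).+1
             | is_composition (csize p) (map val js))
        aop (cblocks (@fmor _ D C F) (map val js) p)))).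
  transitivity (path_sum c (fun rs (p : achain (fs_obj S i0) (fs_obj T j0)) =>
    \sum_(1 <= i < (csize c).+1)
      \sum_(js : i.-tuple 'I_(csize c).+1
             | is_composition (csize c) (map val js))
        (-1) ^ (enl_op_sign a rs) *:
          aop (cblocks (@fmor _ D C F) (map val js) p))); last first.
    apply: path_sum_ext => rs p cp; have [-> _] := path_size cp.
    by rewrite scaler_sumr; apply: eq_bigr => l _; rewrite scaler_sumr.
  rewrite mxentry_sum path_sum_sum; apply: eq_bigr => l _.
  rewrite mxentry_sum path_sum_sum; apply: eq_bigr => js /andP[js0 /eqP jsn].
  rewrite mxentryE.
  rewrite (path_sum_blocks a (map val js) c (fun rs => (-1) ^ enl_op_sign a rs)
    (mC _ _)).
  apply: path_sum_ext => rs p cp; have [sp sr] := path_size cp.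
  by rewrite signD block_signE // ?sr.
transitivity (path_sum c (fun rs (p : achain (fs_obj S i0) (fs_obj T j0)) =>
  (\sum_(1 <= l < (csize c).+1) \sum_(0 <= j < ((csize c).+1 - l)%N)
    (-1) ^ (enl_op_sign a rs + \sum_(d <- take j (unshift ds rs (fs_shift T j0))) d) *:
       fmor F (cinsert (@aop K D) p j l)))).
  apply: path_sum_ext => rs p cp; have [sp sr] := path_size cp.
  have [sd hp] := path_homogeneous cp hc.
  (* The entries along the path have suspended degrees [unshift ds rs (fs_shift T j0)], so the
     relation for [F] carries signs in these, not in [ds]. *)
  rewrite (rF _ _ _ _ _ hp) sp //.
  rewrite scaler_sumr; apply: eq_bigr => l _.
  rewrite scaler_sumr; apply: eq_bigr => j _.
  by rewrite scalerA signD.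
rewrite mxentry_sum path_sum_sum; apply: eq_big_nat => l l1.
rewrite mxentry_sum path_sum_sum; apply: eq_big_nat => j j1.
have jl : (j + l <= csize c)%N by lia.
have l0 : (0 < l)%N by case/andP: l1.
have jn : (j < csize c)%N by apply: leq_trans jl; rewrite -addn1 leq_add2l.
rewrite mxentryZ mxentryE.
rewrite (path_sum_insert a (fun rs => (-1) ^ enl_fun_sign a rs)
  (mF (fs_obj S i0) (fs_obj T j0)) l0 jl).
rewrite (path_sum_lin (g := fun x => _ *: x)); last first.
  by move=> k x y; rewrite scalerDr !scalerA mulrC.
apply: path_sum_ext => rs p cp.
have [sp sr] := path_size cp; have [sd hp] := path_homogeneous cp hc.
rewrite scalerA !signD; congr (_ *: _).
(* The shift corrections telescope to r_(j+1) - r_1. *)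
rewrite sum_take_unshift ?sd //.
(* Since [j < csize c], the default values of [head] are never reached. *)
have hd : head (fs_shift T j0) (drop j rs) = head 0 (drop j rs).
  have : (0 < size (drop j rs))%N by rewrite size_drop sr subn_gt0.
  by case: (drop j rs).
have hr : head (fs_shift T j0) rs = head 0 rs.
  by move: c0; rewrite -sr; case: (rs).
rewrite hd hr; congr (_ ^ _); rewrite /enl_fun_sign /enl_op_sign.
(* In both cases the exponents agree as integers, not only modulo 2. For [Enl1] the inner operation
   has exponent r_(j+1), and r_1 cancels on the other side. *)
case: (a).
  have -> : head 0 (take l (drop j rs)) = head 0 (drop j rs).
    by case: (drop j rs) => //; case: (l) l0.
  by ring.
(* For [j = 0] the inserted entry comes first, and its shift is again r_1. *)
have hj : head 0 (take j rs ++ head 0 (drop j rs) :: drop l (drop j rs)) = head 0 rs.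
  by case: (rs) (j) => [|r rs'] [|j'].
have := sum_head_behead (take j rs ++ head 0 (drop j rs) :: drop l (drop j rs)).
rewrite hj big_cat big_cons (big_split_take rs j) (big_split_take (drop j rs) l) /=.
set H := \sum_(_ <- behead _) _ => eH.
have -> : H = \sum_(r <- take j rs) r + (head 0 (drop j rs) +
    \sum_(r <- drop l (drop j rs)) r) - head 0 rs by rewrite eH; ring.
by ring.
Qed.
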